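(* Let $\mu$ and $\nu$ be finite Borel measures on $\mathbb{R}$ with $\operatorname{supp}\mu=[0,1]$ and $0,D\in\operatorname{supp}\nu\subset[0,D]$. Suppose $(b,c)\subset[0,D]$ is a gap in $\operatorname{supp}\nu$. Then: (i) if $c-b>1$, then $\underline{\dim}_{loc}(\mu*\nu)(1+b)=\underline{\dim}_{loc}(\mu\times\nu)(1,b)$; (ii) if $c-b=1$, then $\underline{\dim}_{loc}(\mu*\nu)(1+b)=\min\{\underline{\dim}_{loc}(\mu\times\nu)(1,b),\ \underline{\dim}_{loc}(\mu\times\nu)(0,c)\}$.
   Context: $\operatorname{supp}\mu$ is the support of $\mu$ and $B(x,r)$ is the ball of center $x$ and radius $r$. An interval $(b,c)$ contained in the convex hull of $\operatorname{supp}\nu$ is a gap in $\operatorname{supp}\nu$ if $b,c\in\operatorname{supp}\nu$ and $(b,c)\cap\operatorname{supp}\nu=\emptyset$. For a measure $\mu$ on a metric space and $x\in\operatorname{supp}\mu$, the lower local dimension is $\underline{\dim}_{loc}\mu(x)=\liminf_{r\to0}\frac{\log(\mu(B(x,r)))}{\log r}$. The convolution is $(\mu*\nu)(A)=\iint\chi_A(x+y)\,d\mu(x)\,d\nu(y)$. $\mu\times\nu$ is the product measure on $\mathbb{R}^2$, with the maximum metric, so that $B((x,y),r)=B(x,r)\times B(y,r)$. *)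

(* Defs.v *)
From HB Require Import structures.
From mathcomp Require Import all_boot all_order all_algebra.
From mathcomp Require Import all_classical all_reals all_analysis.

Set Implicit Arguments.
Unset Strict Implicit.
Unset Printing Implicit Defensive.

Import Order.TTheory GRing.Theory Num.Theory.
Import numFieldNormedType.Exports.

Local Open Scope classical_set_scope.
Local Open Scope ring_scope.
Local Open Scope ereal_scope.

Definition msupp (R : realType) (T : pseudoMetricType R)
    (mu : set T -> \bar R) : set T :=
  [set x | forall r : R, (0 < r)%R -> 0 < mu (ball x r)].

(* [set` Rhull A] is the convex hull of A. *)
Definition is_gap (R : realType) (A : set R) (b c : R) : Prop :=
  [/\ (b < c)%R, `]b, c[ `<=` [set` Rhull A], A b, A c & `]b, c[ `&` A = set0].

(* On T = R * R, ball (x, y) r is ball x r `*` ball y r, i.e. the ball of the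
   maximum metric.  The quotient is only meaningful for 0 < r < 1 and finite
   mu (ball x r), and it is +oo there if mu (ball x r) = 0. *)
Definition lower_local_dim (R : realType) (T : pseudoMetricType R)
    (mu : set T -> \bar R) (x : T) : \bar R :=
  limf_einf (fun r : R => lne (mu (ball x r)) / (ln r)%:E) (0%R : R)^'+.

Definition convolution (R : realType)
    (mu nu : set (measurableTypeR R) -> \bar R) : set R -> \bar R :=
  fun A => \int[nu]_y \int[mu]_x (\1_A (x + y)%R)%:E.

(* Main.v *)
Require Import Defs.
From HB Require Import structures.
From mathcomp Require Import all_boot all_order all_algebra.
From mathcomp Require Import all_classical all_reals all_analysis.
From mathcomp Require Import measurable_realfun lra.
Import Order.TTheory GRing.Theory Num.Theory.
Import numFieldNormedType.Exports.
Local Open Scope classical_set_scope.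
Local Open Scope ring_scope.
Local Open Scope ereal_scope.

(** Near the point [1 + b], the convolution is comparable with the product
    measure near the pairs [(x, y)] of the product of the supports with
    [x + y = 1 + b] that can contribute. Since [mu * nu] of a set [A] is the
    product measure of [{(x, y) | x + y \in A}] ([convolutionE]), two
    inclusions suffice.

    - For all [x], [y], if [(u, v)] lies in [B((x, y), r)], then [u + v] lies
      in [B(x + y, 2 r)]. Hence the lower local dimension of [mu * nu] at
      [x + y] is at most that of the product at [(x, y)]
      ([lower_local_dim_convolution_le]).
    - If [x] is in [[0, 1]], [y] is in the support of [nu] and [x + y] lies in
      [B(1 + b, r)], then either [y <= b], and both [1 - x] and [b - y] are
      less than [r], or [y >= c >= 1 + b], and both [x] and [y - c] are less
      than [r]. The second alternative is impossible for small [r] when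
      [c - b > 1]. As the complement of the support is negligible, the mass of
      [B(1 + b, r)] is at most the sum of the product masses of the balls
      around [(1, b)] and, when [c - b = 1], around [(0, c)]
      ([convolution_ball_le1], [convolution_ball_le2]).

    Such bounds pass to dimensions because, for small [r], the inequality
    [t < log m / log r] means [m < r ^ t] ([lt_log_quotient]): a dimension
    larger than [t] gives the bound [r ^ t], and a bound [r ^ s] with [s < t],
    which absorbs the constant factors coming from sums and from doubled
    radii, gives a dimension at least [s] ([lower_local_dim_le_doubling],
    [le_lower_local_dim_add]). These bounds treat null balls and balls of mass
    larger than one like all others. *)

(** * Lower limits and lower local dimensions *)

Lemma lt_limf_einf_near (R : realType) (T : choiceType) (X : filteredType T)
    (f : X -> \bar R) (F : set_system X) (x : \bar R) : Filter F ->
  x < limf_einf f F -> \forall y \near F, x < f y.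
Proof.
move=> FF; rewrite limf_einfE => /ereal_sup_gt[_ [V FV <-] xV].
apply: filterS FV => y Vy; apply: (lt_le_trans xV).
by apply: ereal_inf_lbound; exists y.
Qed.

Lemma le_limf_einf_near (R : realType) (T : choiceType) (X : filteredType T)
    (f : X -> \bar R) (F : set_system X) (x : \bar R) :
  (\forall y \near F, x <= f y) -> x <= limf_einf f F.
Proof.
move=> Fx; rewrite limf_einfE.
apply: (@le_trans _ _ (ereal_inf (f @` [set y | x <= f y]))).
  by apply: le_ereal_inf_tmp => _ [y xy <-].
by apply: ereal_sup_ubound; exists [set y | x <= f y].
Qed.

(** The slack between [s] and [t] is what absorbs constant factors below. *)
Lemma lee_of_lt_lt (R : realType) (x y : \bar R) :
  (forall s t : R, (s < t)%R -> t%:E < x -> s%:E <= y) -> x <= y.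
Proof.
move=> h; rewrite leNgt; apply/negP => yx.
have [z z0] : exists z : R, y < z%:E < x.
  case: x y yx {h} => [x||] [y||]//= yx.
  - by exists ((y + x) / 2)%R; rewrite !lte_fin in yx *; lra.
  - by exists (x - 1)%R; rewrite ltNyr lte_fin/=; lra.
  - by exists (y + 1)%R; rewrite ltry lte_fin/= andbT; lra.
  - by exists 0%R; rewrite ltNyr ltry.
have [t t0] : exists t : R, z%:E < t%:E < x.
  case: x z0 {yx h} => [x||] /andP[_ yx]//=.
  - by exists ((z + x) / 2)%R; rewrite !lte_fin in yx *; lra.
  - by exists (z + 1)%R; rewrite ltry lte_fin/= andbT; lra.
move: z0 t0 => /andP[yz _] /andP[zt tx].
by have := lt_le_trans yz (h z t zt tx); rewrite ltxx.
Qed.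

(** Also valid for [m = 0] and [m = +oo], where the quotient is [+oo] and [-oo]. *)
Lemma lt_log_quotient (R : realType) (m : \bar R) (r t : R) :
  0 <= m -> (0 < r < 1)%R ->
  (t%:E < lne m / (ln r)%:E) = (m < (r `^ t)%:E).
Proof.
move=> m0 /andP[r0 r1].
have lr : (ln r < 0)%R by rewrite ln_lt0// r0 r1.
rewrite inver (lt_eqF lr) lte_ndivlMr//.
case: m m0 => [m||]//=; rewrite lee_fin => m0.
case: ifPn => [m0'|]; last rewrite -ltNge => m0'.
  by rewrite ltNyr lte_fin (le_lt_trans m0')// powR_gt0.
by rewrite !lte_fin -ln_powR ltr_ln// posrE powR_gt0.
Qed.

Lemma le_log_quotient (R : realType) (m : \bar R) (r t : R) :
  0 <= m -> (0 < r < 1)%R ->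
  (t%:E <= lne m / (ln r)%:E) = (m <= (r `^ t)%:E).
Proof.
move=> m0 /andP[r0 r1].
have lr : (ln r < 0)%R by rewrite ln_lt0// r0 r1.
rewrite inver (lt_eqF lr) lee_ndivlMr//.
case: m m0 => [m||]//=; rewrite lee_fin => m0.
case: ifPn => [m0'|]; last rewrite -ltNge => m0'.
  by rewrite leNye lee_fin (le_trans m0')// powR_ge0.
by rewrite !lee_fin -ln_powR ler_ln// posrE powR_gt0.
Qed.

Lemma near_right0_lt1 (R : realType) : \forall r \near (0%R : R)^'+, (0 < r < 1)%R.
Proof.
by near=> r; apply/andP; split; near: r; [exact: nbhs_right_gt|exact: nbhs_right_lt].
Unshelve. all: by end_near. Qed.

Lemma lt_lower_local_dim {R : realType} {T : pseudoMetricType R}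
    {mu : set T -> \bar R} {x : T} {t : R} :
  (forall A, 0 <= mu A) -> t%:E < lower_local_dim mu x ->
  \forall r \near (0%R : R)^'+, mu (ball x r) < (r `^ t)%:E.
Proof.
move=> mu0 /lt_limf_einf_near h.
near=> r; rewrite -lt_log_quotient//; first by near: r; exact: h.
by near: r; exact: near_right0_lt1.
Unshelve. all: by end_near. Qed.

Lemma le_lower_local_dim (R : realType) (T : pseudoMetricType R)
    (mu : set T -> \bar R) (x : T) (t : R) :
  (forall A, 0 <= mu A) ->
  (\forall r \near (0%R : R)^'+, mu (ball x r) <= (r `^ t)%:E) ->
  t%:E <= lower_local_dim mu x.
Proof.
move=> mu0 h; apply: le_limf_einf_near.
near=> r; rewrite le_log_quotient//; first by near: r.
by near: r; exact: near_right0_lt1.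
Unshelve. all: by end_near. Qed.

Lemma near_mul_powR_le (R : realType) (C s t : R) : (0 < C)%R -> (s < t)%R ->
  \forall r \near (0%R : R)^'+, (C * r `^ t <= r `^ s)%R.
Proof.
move=> C0 st.
have ts : (0 < t - s)%R by rewrite subr_gt0.
have h : \forall r \near (0%R : R)^'+, (r `^ (t - s) < C^-1)%R.
  by apply: (cvgr_lt _ (powR_cvg0 ts)); rewrite invr_gt0.
near=> r.
have r0 : (0 < r)%R by near: r; exact: nbhs_right_gt.
have -> : t = ((t - s) + s)%R by rewrite subrK.
rewrite powRD ?(gt_eqF r0) ?implybT// mulrA ler_piMl ?powR_ge0//.
by rewrite -ler_pdivlMl// mulr1; apply: ltW; near: r; exact: h.
Unshelve. all: by end_near. Qed.

Lemma lower_local_dim_le_doubling (R : realType) (T T' : pseudoMetricType R)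
    (mu : set T -> \bar R) (nu : set T' -> \bar R) (x : T) (y : T') :
  (forall A, 0 <= mu A) -> (forall A, 0 <= nu A) ->
  (forall r : R, (0 < r)%R -> mu (ball x r) <= nu (ball y (r * 2)%R)) ->
  lower_local_dim nu y <= lower_local_dim mu x.
Proof.
move=> mu0 nu0 munu; apply: lee_of_lt_lt => s t st.
move=> /(lt_lower_local_dim nu0)[e /= e0 he].
apply: le_lower_local_dim => //; near=> r.
have r0 : (0 < r)%R by near: r; exact: nbhs_right_gt.
apply: (le_trans (munu r r0)); apply: (@le_trans _ _ ((r * 2) `^ t)%:E).
  apply/ltW/he; last by rewrite mulr_gt0.
  rewrite /= sub0r normrN gtr0_norm ?mulr_gt0// -ltr_pdivlMr//.
  by near: r; apply: nbhs_right_lt; rewrite divr_gt0.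
rewrite powRM ?(ltW r0)// lee_fin mulrC.
by near: r; apply: near_mul_powR_le => //; rewrite powR_gt0.
Unshelve. all: by end_near. Qed.

Lemma le_lower_local_dim_add (R : realType) (T1 T2 T : pseudoMetricType R)
    (mu1 : set T1 -> \bar R) (mu2 : set T2 -> \bar R) (mu : set T -> \bar R)
    (x1 : T1) (x2 : T2) (x : T) :
  (forall A, 0 <= mu1 A) -> (forall A, 0 <= mu2 A) -> (forall A, 0 <= mu A) ->
  (\forall r \near (0%R : R)^'+,
     mu (ball x r) <= mu1 (ball x1 r) + mu2 (ball x2 r)) ->
  Order.min (lower_local_dim mu1 x1) (lower_local_dim mu2 x2)
    <= lower_local_dim mu x.
Proof.
move=> mu10 mu20 mu0 h; apply: lee_of_lt_lt => s t st; rewrite lt_min => /andP[].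
move=> /(lt_lower_local_dim mu10) h1.
move=> /(lt_lower_local_dim mu20) h2.
apply: le_lower_local_dim => //; near=> r.
have hr : mu (ball x r) <= mu1 (ball x1 r) + mu2 (ball x2 r) by near: r.
apply: (le_trans hr); apply: (@le_trans _ _ ((r `^ t)%:E + (r `^ t)%:E)).
  by apply: leeD; apply: ltW; near: r.
rewrite -EFinD lee_fin -mulr2n -mulr_natl.
by near: r; exact: near_mul_powR_le.
Unshelve. all: by end_near. Qed.

(** * Negligibility of the complement of the support *)

(** The complement of the support is covered by the countably many null balls
    with rational center and radius. *)
Lemma negligible_setC_msupp {R : realType}
    (mu : {measure set (measurableTypeR R) -> \bar R}) :
  mu.-negligible (~` @msupp R R mu).
Proof.
(* [N] enumerates the null balls with rational center and radius, with the
   empty set at the other indices. *)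
pose B (n : nat) : set R :=
  if unpickle n is Some p then ball (ratr p.1 : R) (ratr p.2 : R) else set0.
pose N n : set (measurableTypeR R) := if mu (B n) == 0 then B n else set0.
have : mu.-negligible (\bigcup_n N n).
  apply: negligible_bigcup => n; rewrite /N.
  case: ifPn => [/eqP Bn0|_]; last exact: negligible_set0.
  exists (B n); split => //; rewrite /B.
  by case: unpickle => [p|]; [exact: measurable_ball|exact: measurable0].
apply: negligibleS.
move=> x /= /existsNP[r /not_implyP[r0 /negP]].
rewrite -leNgt measure_le0 => /eqP br0.
have oB : open (ball (x : R) r) by exact: ball_open.
have [p [q [xpq pqr]]] := open_subball_rat oB (mem_set (ballxx (x : R) r0)).
exists (pickle (p, q)) => //.
have -> : N (pickle (p, q)) = ball (ratr p : R) (ratr q : R); last exact/set_mem.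
rewrite /N /B pickleK/= ifT//; apply/eqP.
by apply: (@subset_measure0 _ (measurableTypeR R) R mu _ _ _ _ pqr br0);
  exact: measurable_ball.
Qed.

(** * Convolution and product measure *)

Lemma notin_gap {R : realType} {A : set R} {b c y : R} :
  `]b, c[ `&` A = set0 -> A y -> (y <= b)%R \/ (c <= y)%R.
Proof.
move=> gap Ay; have [yb|yb] := leP y b; first by left.
have [yc|yc] := leP c y; first by right.
have : (`]b, c[ `&` A) y by split => //=; rewrite in_itv/= yb yc.
by rewrite gap.
Qed.

Section convolution.
Context {R : realType} (mu nu : {finite_measure set (measurableTypeR R) -> \bar R}).

Lemma measurable_add_preimage {A : set R} : measurable A ->
  measurable [set p : measurableTypeR R * measurableTypeR R | A (p.1 + p.2)%R].
Proof.
move=> mA.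
have := @measurable_funD _ (measurableTypeR R * measurableTypeR R)%type R setT
  fst snd measurable_fst measurable_snd.
by move=> /(_ measurableT A mA); rewrite setTI.
Qed.

Lemma convolutionE (A : set R) : measurable A ->
  convolution mu nu A
    = (mu \x nu) [set p : measurableTypeR R * measurableTypeR R | A (p.1 + p.2)%R].
Proof.
move=> mA; have mS := measurable_add_preimage mA.
have -> := @product_measure_unique _ _ _ _ _ mu nu (mu \x^ nu) _ _ mS; last first.
  by move=> B C mB mC; exact: product_measure2E.
apply: eq_integral => y _ /=.
have mAy := measurable_ysection y mS.
rewrite -[in RHS](setIT (ysection _ _)) -integral_indic// ysectionE.
by apply: eq_integral => x _; rewrite !indicE.
Qed.

Lemma convolution_ge0 (A : set R) : 0 <= convolution mu nu A.
Proof.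
by apply: integral_ge0 => y _; apply: integral_ge0 => x _; rewrite lee_fin.
Qed.

Lemma negligible_setC_msupp_prod :
  (mu \x nu).-negligible
    (~` (@msupp R R mu `*` @msupp R R nu) : set (measurableTypeR R * measurableTypeR R)).
Proof.
have [A [mA A0 sA]] := negligible_setC_msupp mu.
have [B [mB B0 sB]] := negligible_setC_msupp nu.
have nA : (mu \x nu).-negligible (A `*` setT).
  exists (A `*` setT); split => //; first exact: measurableX.
  by rewrite product_measure1E// A0 mul0e.
have nB : (mu \x nu).-negligible (setT `*` B).
  exists (setT `*` B); split => //; first exact: measurableX.
  by rewrite product_measure1E// B0 mule0.
apply: negligibleS (negligibleU nA nB) => -[x y] /= /not_andP[hx|hy].
  by left; split => //=; exact: sA.
by right; split => //=; exact: sB.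
Qed.

Lemma convolution_ball_ge (x y r : R) : (0 < r)%R ->
  (mu \x nu) (ball ((x, y) : R * R) r)
    <= convolution mu nu (ball (x + y)%R (r * 2)%R).
Proof.
move=> r0; rewrite convolutionE; last exact: measurable_ball.
apply: le_measure; rewrite ?inE.
- by apply: measurableX; exact: measurable_ball.
- by apply: measurable_add_preimage; exact: measurable_ball.
- move=> [u v] [/=]; rewrite /ball /= => xu yv.
  rewrite opprD addrACA mulr2n mulrDr mulr1.
  by rewrite (le_lt_trans (ler_normD _ _))// ltrD.
Qed.

(** Only the part of [A] inside the product of the supports has mass. *)
Lemma product_measure_le_on_msupp
    (A B : set (measurableTypeR R * measurableTypeR R)) :
  measurable A -> measurable B ->
  A `&` (@msupp R R mu `*` @msupp R R nu) `<=` B ->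
  (mu \x nu) A <= (mu \x nu) B.
Proof.
move=> mA mB AB; have [N [mN N0 sN]] := negligible_setC_msupp_prod.
apply: (@le_trans _ _ ((mu \x nu) (B `|` N))).
  apply: le_measure; rewrite ?inE//; first exact: measurableU.
  move=> p Ap; have [sp|nsp] := pselect ((@msupp R R mu `*` @msupp R R nu) p).
    by left; exact: AB.
  by right; exact: sN.
by rewrite -[leRHS]adde0 -[in leRHS]N0; exact: measureU2.
Qed.

(** For such [r], no [y >= c] satisfies [x + y < 1 + b + r] with [x >= 0]. *)
Lemma convolution_ball_le1 (b c r : R) :
  @msupp R R mu `<=` `[0%R, 1%R] -> `]b, c[ `&` @msupp R R nu = set0 ->
  (r <= c - b - 1)%R ->
  convolution mu nu (ball (1 + b)%R r) <= (mu \x nu) (ball ((1, b) : R * R)%R r).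
Proof.
move=> smu gap rcb; rewrite convolutionE; last exact: measurable_ball.
apply: product_measure_le_on_msupp.
- by apply: measurable_add_preimage; exact: measurable_ball.
- by apply: measurableX; exact: measurable_ball.
move=> [x y] [/= + [/= /smu + sy]]; rewrite !ball_itv/= !in_itv/=.
move=> /andP[xy1 xy2] /andP[x0 x1].
have [yb|cy] := notin_gap gap sy; clear gap; last lra.
by split; rewrite /= ball_itv/= in_itv/=; lra.
Qed.

Lemma convolution_ball_le2 (b c r : R) :
  @msupp R R mu `<=` `[0%R, 1%R] -> `]b, c[ `&` @msupp R R nu = set0 ->
  (1 <= c - b)%R ->
  convolution mu nu (ball (1 + b)%R r)
    <= (mu \x nu) (ball ((1, b) : R * R)%R r)
       + (mu \x nu) (ball ((0, c) : R * R)%R r).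
Proof.
move=> smu gap cb; rewrite convolutionE; last exact: measurable_ball.
have mball (u v : R) : measurable
    (ball ((u, v) : R * R) r : set (measurableTypeR R * measurableTypeR R)).
  by apply: measurableX; exact: measurable_ball.
apply: le_trans (measureU2 (mu \x nu) (mball _ _) (mball _ _)).
apply: product_measure_le_on_msupp.
- by apply: measurable_add_preimage; exact: measurable_ball.
- exact: measurableU.
move=> [x y] [/= + [/= /smu + sy]]; rewrite !ball_itv/= !in_itv/=.
move=> /andP[xy1 xy2] /andP[x0 x1].
have [yb|cy] := notin_gap gap sy; clear gap.
  by left; split; rewrite /= ball_itv/= in_itv/=; lra.
by right; split; rewrite /= ball_itv/= in_itv/=; lra.
Qed.

Lemma lower_local_dim_convolution_le (x y : R) :
  lower_local_dim (convolution mu nu) (x + y)%R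
    <= @lower_local_dim R (R * R)%type (mu \x nu) (x, y).
Proof.
apply: lower_local_dim_le_doubling => //; first exact: convolution_ge0.
exact: convolution_ball_ge.
Qed.

End convolution.

Theorem theorem4p6 (R : realType)
    (mu nu : {finite_measure set (measurableTypeR R) -> \bar R}) (D b c : R) :
  @msupp R R mu = `[0%R, 1%R]%classic ->
  @msupp R R nu 0%R -> @msupp R R nu D -> @msupp R R nu `<=` `[0%R, D] ->
  `]b, c[ `<=` `[0%R, D] -> is_gap (@msupp R R nu) b c ->
  ((1 < c - b)%R ->
     lower_local_dim (convolution mu nu) (1 + b)%R
       = @lower_local_dim R (R * R)%type (mu \x nu) (1%R, b)) /\
  ((c - b = 1)%R ->
     lower_local_dim (convolution mu nu) (1 + b)%R
       = Order.min (@lower_local_dim R (R * R)%type (mu \x nu) (1%R, b))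
                   (@lower_local_dim R (R * R)%type (mu \x nu) (0%R, c))).
Proof.
move=> smu _ _ _ _ [_ _ _ _ gap].
have smu01 : @msupp R R mu `<=` `[0%R, 1%R] by rewrite smu.
have prod0 A : 0 <= (mu \x nu) A by [].
split=> cb; apply/eqP; rewrite eq_le; apply/andP; split.
- exact: lower_local_dim_convolution_le.
(* One ball is enough here: it is taken twice in the two-ball comparison. *)
- rewrite -[leLHS]minxx; apply: le_lower_local_dim_add => //.
    exact: convolution_ge0.
  near=> r; apply: le_trans (leeDl _ (prod0 _)).
  apply: (convolution_ball_le1 _ _ _ c) => //.
  by near: r; apply: nbhs_right_le; rewrite subr_gt0.
- rewrite le_min; apply/andP; split; first exact: lower_local_dim_convolution_le.
  have -> : (1 + b = 0 + c)%R by lra.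
  exact: lower_local_dim_convolution_le.
- apply: le_lower_local_dim_add => //; first exact: convolution_ge0.
  near=> r; apply: convolution_ball_le2 => //.
  by rewrite cb.
Unshelve. all: by end_near. Qed.
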